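(* The categorical quotient of $\mathbb C^4$ under the $(\mathbb C^* )^2$-action described by the matrix $$A=\begin{bmatrix}1&1&1&1\\0&0&1&-1\end{bmatrix},$$ linearized by $\alpha=(2,0)$, is the weighted projective space $\mathbb{CP}_{1,1,2}$.
   Context: Let $T=(\mathbb C^* )^2$. The action described by $A$ is $(t_1,t_2)\cdot(X,Y,Z,W)=(t_1X,\;t_1Y,\;t_1t_2Z,\;t_1t_2^{-1}W)$. For $\alpha=(\alpha_1,\alpha_2)\in\mathbb Z^2$, the linearization $L_\alpha$ is the trivial line bundle on $\mathbb C^4$ with $T$-action $t\cdot(v,w)=(t\cdot v,\;t_1^{\alpha_1}t_2^{\alpha_2}w)$. The $T$-invariant sections of $L_\alpha^{\otimes d}$ are the polynomials $G$ on $\mathbb C^4$ with $G(t\cdot v)=(t_1^{\alpha_1}t_2^{\alpha_2})^{d}G(v)$ for all $t\in T$. A point is semi-stable with respect to $L_\alpha$ if it lies in $\mathbb C^4\setminus\{s=0\}$ for some $d>0$ and some $T$-invariant section $s$ of $L_\alpha^{\otimes d}$; otherwise it is unstable. The categorical quotient of $\mathbb C^4$ linearized by $\alpha$, denoted $\mathbb C^4/\!\!/_\alpha T$, is the categorical quotient of the semi-stable locus $(\mathbb C^4)^{ss}(L_\alpha)$ by $T$. A categorical quotient of a $T$-variety $V$ is a $T$-invariant morphism $p:V\to Q$ such that every $T$-invariant morphism $V\to Q'$ factors uniquely through $p$. The weighted projective space $\mathbb{CP}_{1,1,2}$ is the quotient of $\mathbb C^3\setminus\{0\}$ by the $\mathbb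 C^*$-action $\lambda\cdot(x,y,z)=(\lambda x,\lambda y,\lambda^2z)$. *)

(* Defs.v *)
From HB Require Import structures.
From mathcomp Require Import all_boot all_order all_algebra.
From mathcomp Require Import all_classical reals topology.
From mathcomp Require Export complex.
From mathcomp Require mpoly.
Import -(notations) mpoly.

Set Implicit Arguments.
Unset Strict Implicit.
Unset Printing Implicit Defensive.

Import Order.TTheory GRing.Theory Num.Theory.
Local Open Scope classical_set_scope.
Local Open Scope ring_scope.
Local Open Scope quotient_scope.

(* Complex varieties are treated classically, as topological spaces with a
   sheaf of C-valued functions, where C := R[i] for R the real numbers. *)

(* [regular U f] means that the restriction of f to the open set U belongs to
   O_X(U). It is only ever used for U open, and for a sheaf (see
   [sheaf_of_functions]) it depends only on the values of f on U. *)
Record funspace (R : realType) := FunSpace {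
  funspace_sort :> topologicalType;
  regular : set funspace_sort -> (funspace_sort -> R[i]) -> Prop }.

(* For open U, a function is regular on U iff it agrees near every point of U
   with a regular function: this is at once restriction, gluing, and
   independence of the values outside U. *)
Definition sheaf_of_functions (R : realType) (X : funspace R) : Prop :=
  forall (U : set X) (f : X -> R[i]), open U ->
    (regular U f <->
     forall x, U x -> exists (V : set X) (g : X -> R[i]),
       [/\ open V, V x, regular V g & forall y, U y -> V y -> f y = g y]).

Definition morphism (R : realType) (X Y : funspace R) (f : X -> Y) : Prop :=
  continuous f /\
  forall (V : set Y) (g : Y -> R[i]),
    open V -> regular V g -> regular (f @^-1` V) (g \o f).

Definition isomorphic (R : realType) (X Y : funspace R) : Prop :=
  exists (f : X -> Y) (g : Y -> X),
    [/\ morphism f, morphism g, cancel f g & cancel g f].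

(* Affine space C^n with its Zariski topology; an alias, so that no other
   topology on functions into R[i] is inferred. *)
Definition affine_pt (R : realType) (n : nat) : Type := 'I_n -> R[i].

HB.instance Definition _ (R : realType) (n : nat) :=
  Choice.copy (affine_pt R n) ('I_n -> R[i]).

Definition zero_locus (R : realType) (n : nat)
    (S : set (mpoly n R[i])) : set (affine_pt R n) :=
  [set x | forall P, S P -> meval x P = 0].

Definition zariski_open (R : realType) (n : nat) (U : set (affine_pt R n)) :
    Prop :=
  exists S : set (mpoly n R[i]), ~` U = zero_locus S.

Lemma zariski_openT (R : realType) (n : nat) :
  zariski_open [set: affine_pt R n].
Proof.
exists [set 1]; rewrite setCT; apply/seteqP; split => x //= /(_ _ erefl).
by rewrite meval1 => /eqP; rewrite oner_eq0.
Qed.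

Lemma zariski_openI (R : realType) (n : nat) :
  setI_closed (@zariski_open R n).
Proof.
move=> U V [S US] [S' VS'].
exists [set P | exists P1 P2, [/\ S P1, S' P2 & P = P1 * P2]].
rewrite setCI US VS'; apply/seteqP; split => x /=.
  move=> Hx _ [P1 [P2 [SP1 SP2 ->]]]; rewrite mevalM.
  by case: Hx => [/(_ _ SP1)|/(_ _ SP2)] ->; rewrite ?mul0r ?mulr0.
move=> Hx; apply: contrapT => /not_orP[/existsNP[P1 /not_implyP[SP1 /eqP N1]]].
move=> /existsNP[P2 /not_implyP[SP2 /eqP N2]].
have := Hx (P1 * P2) (ex_intro _ P1 (ex_intro _ P2 (And3 SP1 SP2 erefl))).
by rewrite mevalM => /eqP; rewrite mulf_eq0 (negbTE N1) (negbTE N2).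
Qed.

Lemma zariski_open_bigU (R : realType) (n : nat) (I : Type)
    (F : I -> set (affine_pt R n)) :
  (forall i, zariski_open (F i)) -> zariski_open (\bigcup_i F i).
Proof.
move=> /choice[S FS]; exists (\bigcup_i S i); rewrite setC_bigcup.
apply/seteqP; split => x /= Hx.
  by move=> P [i _ SP]; have := Hx i Logic.I; rewrite FS; apply.
by move=> i _; rewrite FS => P SP; apply: Hx; exists i.
Qed.

HB.instance Definition _ (R : realType) (n : nat) :=
  @isOpenTopological.Build (affine_pt R n) (@zariski_open R n)
    (@zariski_openT R n) (@zariski_openI R n) (@zariski_open_bigU R n).

Definition affine_space (R : realType) (n : nat) : funspace R :=
  @FunSpace R (affine_pt R n) (fun U f =>
    forall x, U x -> exists (V : set (affine_pt R n)) (P Q : mpoly n R[i]),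
      [/\ open V, V x & forall y, U y -> V y ->
         meval y Q != 0 /\ f y = meval y P / meval y Q]).

(* A subset with the subspace topology and the induced sheaf: functions that
   locally extend to regular functions on the ambient space. *)
Definition subspace_of (R : realType) (X : funspace R) (A : set X) :
    funspace R :=
  @FunSpace R (set_type A) (fun U f =>
    forall x, U x -> exists (V : set X) (g : X -> R[i]),
      [/\ open V, V (\val x), regular V g &
          forall y, U y -> V (\val y) -> f y = g (\val y)]).

(* Quotient topology; a function is regular iff its pullback is. *)
Definition quotient_space (R : realType) (X : funspace R) (e : equiv_rel X) :
    funspace R :=
  @FunSpace R (quotient_topology {eq_quot e}) (fun U f =>
    @regular R X (\pi_({eq_quot e}) @^-1` U) (f \o \pi_({eq_quot e}))).

Definition affine_variety (R : realType) (X : funspace R) : Prop :=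
  exists (n : nat) (Z : set (affine_space R n)),
    closed Z /\ isomorphic X (subspace_of Z).

(* Separatedness, in the form: two morphisms from an affine variety agree on a
   closed set (equivalently, the diagonal is closed). *)
Definition separated (R : realType) (X : funspace R) : Prop :=
  forall (Z : funspace R) (f g : Z -> X), affine_variety Z ->
    morphism f -> morphism g -> closed [set z | f z = g z].

(* Varieties are reduced and separated but not required to be irreducible. *)
Definition variety (R : realType) (X : funspace R) : Prop :=
  [/\ sheaf_of_functions X,
      exists (k : nat) (U : 'I_k -> set X),
        (forall i, open (U i) /\ affine_variety (subspace_of (U i))) /\
        \bigcup_i U i = [set: X]
    & separated X].

Definition invariant_map (G V W : Type) (act : G -> V -> V) (f : V -> W) : Prop :=
  forall g v, f (act g v) = f v.

Definition categorical_quotient (R : realType) (G : Type) (V Q : funspace R)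
    (act : G -> V -> V) (p : V -> Q) : Prop :=
  [/\ variety Q, morphism p, invariant_map act p &
      forall (Q' : funspace R) (f : V -> Q'),
        variety Q' -> morphism f -> invariant_map act f ->
        exists! h : Q -> Q', morphism h /\ h \o p = f].

Definition torus (R : realType) (m : nat) : Type :=
  {t : 'I_m -> R[i] | forall i, t i != 0}.

Definition character (R : realType) (m : nat) (alpha : 'I_m -> int)
    (t : torus R m) : R[i] :=
  \prod_(i < m) sval t i ^ alpha i.

(* The j-th coordinate is scaled by the character given by the j-th column. *)
Definition torus_act (R : realType) (m n : nat) (A : 'M[int]_(m, n))
    (t : torus R m) (v : affine_space R n) : affine_space R n :=
  fun j => character (A ^~ j) t * v j.

Definition invariant_section (R : realType) (m n : nat) (A : 'M[int]_(m, n))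
    (alpha : 'I_m -> int) (d : nat) (G : mpoly n R[i]) : Prop :=
  forall (t : torus R m) (v : affine_space R n),
    meval (torus_act A t v) G = character alpha t ^+ d * meval v G.

Definition semistable (R : realType) (m n : nat) (A : 'M[int]_(m, n))
    (alpha : 'I_m -> int) : set (affine_space R n) :=
  [set v | exists (d : nat) (s : mpoly n R[i]),
     [/\ (0 < d)%N, invariant_section A alpha d s & meval v s != 0]].

Lemma semistable_act (R : realType) (m n : nat) (A : 'M[int]_(m, n))
    (alpha : 'I_m -> int) (t : torus R m) (v : affine_space R n) :
  v \in semistable A alpha -> torus_act A t v \in semistable A alpha.
Proof.
rewrite !inE => -[d [s [d0 sinv sv]]]; exists d, s; split => //.
rewrite sinv mulf_neq0// expf_neq0//; apply/prodf_neq0 => i _.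
exact/expfz_neq0/(svalP t).
Qed.

Definition semistable_locus (R : realType) (m n : nat) (A : 'M[int]_(m, n))
    (alpha : 'I_m -> int) : funspace R :=
  subspace_of (@semistable R m n A alpha).

Definition semistable_torus_act (R : realType) (m n : nat)
    (A : 'M[int]_(m, n)) (alpha : 'I_m -> int) (t : torus R m)
    (v : semistable_locus R A alpha) : semistable_locus R A alpha :=
  exist _ (torus_act A t (\val v)) (semistable_act t (valP v)).

Definition punctured_space (R : realType) (n : nat) : funspace R :=
  subspace_of (~` [set (fun=> 0) : affine_space R n]).

Definition weighted_orbit (R : realType) (n : nat) (w : 'I_n -> nat) :
    rel (punctured_space R n) :=
  fun u v => `[< exists2 l : R[i], l != 0 &
                   forall i, \val v i = l ^+ w i * \val u i >].

Lemma weighted_orbit_refl (R : realType) (n : nat) (w : 'I_n -> nat) :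
  reflexive (@weighted_orbit R n w).
Proof.
by move=> u; apply/asboolP; exists 1; rewrite ?oner_eq0// => i;
  rewrite expr1n mul1r.
Qed.

Lemma weighted_orbit_sym (R : realType) (n : nat) (w : 'I_n -> nat) :
  ssrbool.symmetric (@weighted_orbit R n w).
Proof.
suff H u v : @weighted_orbit R n w u v -> weighted_orbit w v u.
  by move=> u v; apply/idP/idP; apply: H.
move=> /asboolP[l l0 uv]; apply/asboolP; exists l^-1; first by rewrite invr_eq0.
by move=> i; rewrite uv mulrA exprVn mulVf ?mul1r// expf_neq0.
Qed.

Lemma weighted_orbit_trans (R : realType) (n : nat) (w : 'I_n -> nat) :
  transitive (@weighted_orbit R n w).
Proof.
move=> v u z /asboolP[l l0 uv] /asboolP[k k0 vz]; apply/asboolP.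
by exists (k * l); rewrite ?mulf_neq0// => i; rewrite vz uv mulrA exprMn.
Qed.

Canonical weighted_orbit_equiv (R : realType) (n : nat) (w : 'I_n -> nat) :=
  EquivRel (@weighted_orbit R n w) (@weighted_orbit_refl R n w)
    (@weighted_orbit_sym R n w) (@weighted_orbit_trans R n w).

Definition weighted_projective_space (R : realType) (n : nat)
    (w : 'I_n -> nat) : funspace R :=
  quotient_space (weighted_orbit_equiv R w).

Definition matrixA : 'M[int]_(2, 4) :=
  \matrix_(i < 2, j < 4)
    nth 0 (nth [::] [:: [:: 1; 1; 1;  1];
                        [:: 0; 0; 1; -1]] i) j.

Definition alpha20 (i : 'I_2) : int := nth 0 [:: 2; 0] i.

Definition weights112 (i : 'I_3) : nat := nth 0%N [:: 1; 1; 2]%N i.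

(* Main.v *)
(* The invariant sections of the powers of L_alpha are generated by X^2, XY, Y^2
   and ZW, so the quotient map is p(X,Y,Z,W) = [X:Y:ZW]. Since (x,y,z) |->
   (x,y,z,1) is a section of it, an invariant morphism f on the semistable locus
   descends as soon as it is constant on the fibres of p. Over ZW <> 0 a fibre is
   an orbit; over ZW = 0 it consists of three orbits, the closures of which all
   contain the orbit Z = W = 0, and f is constant on orbit closures because its
   target is separated.

   CP(1,1,2) is covered by {x <> 0} and {y <> 0}, which are planes, and by
   {z <> 0}, which is the quotient of the plane by (a,b) ~ (-a,-b), that is, the
   cone uw = v^2 with u = a^2, v = ab, w = b^2. It is separated because any two
   distinct points lie in an open set {G <> 0} on which they are distinguished by
   some F/G, with F and G linear combinations of x^2, xy, y^2, z. *)
Require Import Defs.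
From mathcomp Require Import all_boot all_algebra all_classical reals topology.
From mathcomp Require Import ring.
From mathcomp Require mpoly.
Import -(notations) mpoly.

Set Implicit Arguments.
Unset Strict Implicit.
Unset Printing Implicit Defensive.

Import GRing.Theory Num.Theory.
Local Open Scope classical_set_scope.
Local Open Scope ring_scope.
Local Open Scope quotient_scope.

Lemma open_local (T : topologicalType) (U : set T) :
  (forall x, U x -> exists V, [/\ open V, V x & V `<=` U]) -> open U.
Proof.
move=> H; rewrite openE => x /H[V [oV Vx VU]].
by rewrite /interior nbhsE; exists V.
Qed.

(** * Spaces with functions *)

Section Funspaces.
Variable R : realType.
Implicit Types X Y Z : funspace R.

Lemma sheaf_glue X :
  (forall (U : set X) f, open U ->
     (forall x, U x -> exists (V : set X) (g : X -> R[i]),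
        [/\ open V, V x, regular V g & forall y, U y -> V y -> f y = g y]) ->
     regular U f) ->
  sheaf_of_functions X.
Proof. by move=> H U f oU; split=> [rf x Ux|]; [exists U, f|exact: H]. Qed.

(** The closure properties of a structure sheaf on which the arguments rest. They hold for affine
    space and pass to subspaces, quotients and isomorphic copies, so they are available for the
    weighted plane before it is known to be a variety. *)
Record geometric X : Prop := Geometric {
  geometric_sheaf : sheaf_of_functions X;
  regular_cst : forall (U : set X) c, open U -> regular U (fun=> c);
  regular_add : forall (U : set X) f g, open U ->
    regular U f -> regular U g -> regular U (fun x => f x + g x);
  regular_mul : forall (U : set X) f g, open U ->
    regular U f -> regular U g -> regular U (fun x => f x * g x);
  open_neq0 : forall (U : set X) f, open U -> regular U f ->
    open [set x | U x /\ f x != 0];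
  regular_inv : forall (U : set X) f, open U -> regular U f ->
    regular [set x | U x /\ f x != 0] (fun x => (f x)^-1) }.

Lemma regular_sub X (U V : set X) f : sheaf_of_functions X ->
  open U -> open V -> V `<=` U -> regular U f -> regular V f.
Proof.
by move=> sX oU oV VU rf; apply/sX => // x Vx; exists U, f; split=> //; apply: VU.
Qed.

Lemma regular_eq X (U : set X) f g : sheaf_of_functions X -> open U ->
  (forall x, U x -> f x = g x) -> regular U f -> regular U g.
Proof.
move=> sX oU fg rf; apply/sX => // x Ux.
by exists U, f; split=> // y Uy _; rewrite fg.
Qed.

Lemma morphism_comp X Y Z (f : X -> Y) (g : Y -> Z) :
  morphism f -> morphism g -> morphism (g \o f).
Proof.
move=> [cf rf] [cg rg]; split.
  by move=> x; apply: continuous_comp; [exact: cf|exact: cg].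
move=> V h oV rh; have oW : open (g @^-1` V) by move/continuousP: cg; apply.
exact: (rf _ _ oW (rg _ _ oV rh)).
Qed.

Lemma morphism_open X Y (f : X -> Y) (V : set Y) :
  morphism f -> open V -> open (f @^-1` V).
Proof. by move=> [/continuousP cf _]; exact: cf. Qed.

(** * Affine space, its subspaces and their quotients *)

Lemma zariski_open_meval n (P : mpoly n R[i]) :
  open [set x : affine_space R n | meval x P != 0].
Proof.
exists [set P]; apply/seteqP; split=> [x /= /negP|x /= H]; last first.
  by rewrite H// eqxx.
by rewrite negbK => /eqP Px Q ->.
Qed.

Lemma zariski_open_basic n (U : set (affine_space R n)) x : open U -> U x ->
  exists2 P : mpoly n R[i], meval x P != 0 &
    forall y, meval y P != 0 -> U y.
Proof.
move=> [S US] Ux.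
have : ~ (~` U) x by [].
rewrite US => /existsNP[P /not_implyP[SP /eqP Px]]; exists P => // y Py.
apply: contrapT => NUy; have : (~` U) y by [].
by rewrite US => /(_ _ SP) /eqP; apply/negP.
Qed.

Lemma affine_geometric n : geometric (affine_space R n).
Proof.
split.
- apply: sheaf_glue => U f oU H x Ux.
  have [V [g [oV Vx rg fg]]] := H x Ux.
  have [W [P [Q [oW Wx gPQ]]]] := rg x Vx.
  exists (V `&` W), P, Q; split=> [|//|y Uy [Vy Wy]]; first exact: openI.
  by rewrite fg//; apply: gPQ.
- move=> U c oU x Ux; exists U, (mpolyC n c), 1; split=> // y _ _.
  by rewrite mevalC meval1 oner_eq0 divr1.
- move=> U f g oU rf rg x Ux.
  have [V [P [Q [oV Vx fPQ]]]] := rf x Ux.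
  have [W [P' [Q' [oW Wx gPQ]]]] := rg x Ux.
  exists (V `&` W), (P * Q' + P' * Q), (Q * Q'); split=> [|//|y Uy [Vy Wy]].
    exact: openI.
  have [Q0 ->] := fPQ y Uy Vy; have [Q0' ->] := gPQ y Uy Wy.
  rewrite !(mevalD, mevalM) mulf_neq0//; split=> //.
  by rewrite addf_div.
- move=> U f g oU rf rg x Ux.
  have [V [P [Q [oV Vx fPQ]]]] := rf x Ux.
  have [W [P' [Q' [oW Wx gPQ]]]] := rg x Ux.
  exists (V `&` W), (P * P'), (Q * Q'); split=> [|//|y Uy [Vy Wy]].
    exact: openI.
  have [Q0 ->] := fPQ y Uy Vy; have [Q0' ->] := gPQ y Uy Wy.
  by rewrite !mevalM mulf_neq0//; rewrite mulf_div.
- move=> U f oU rf; apply: open_local => x [Ux fx].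
  have [V [P [Q [oV Vx fPQ]]]] := rf x Ux.
  exists ((U `&` V) `&` [set y | meval y P != 0]); split.
  + by apply: openI; [exact: openI|exact: zariski_open_meval].
  + split=> //=; apply: contraNneq fx => Px0.
    by have [_ ->] := fPQ x Ux Vx; rewrite Px0 mul0r.
  + move=> y [[Uy Vy] /= Py]; split=> //.
    by have [Qy ->] := fPQ y Uy Vy; rewrite mulf_neq0// invr_eq0.
- move=> U f oU rf x [Ux fx].
  have [V [P [Q [oV Vx fPQ]]]] := rf x Ux.
  exists V, Q, P; split=> // y [Uy fy] Vy.
  have [Qy fE] := fPQ y Uy Vy; rewrite fE invf_div; split=> //.
  by apply: contraNneq fy => Py0; rewrite fE Py0 mul0r.
Qed.

Lemma open_subspace X (A : set X) (U : set (subspace_of A)) :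
  open U <-> exists2 V : set X, open V & \val @^-1` V = U.
Proof. by split=> [[V oV VU]|[V oV VU]]; exists V. Qed.

Lemma subspace_geometric X (A : set X) :
  geometric X -> geometric (subspace_of A).
Proof.
move=> gX; have sX := geometric_sheaf gX; split.
- apply: sheaf_glue => U f oU H x Ux.
  have [V [g [oV Vx rg fg]]] := H x Ux.
  have [W [h [oW Wx rh gh]]] := rg x Vx.
  have [V' oV' VV'] := (open_subspace V).1 oV.
  exists (V' `&` W), h; split=> [||| y Uy [V'y Wy]].
  + exact: openI.
  + by split=> //; rewrite -VV' in Vx.
  + exact: (regular_sub sX oW (openI oV' oW) (@subIsetr _ _ _) rh).
  + have Vy : V y by rewrite -VV'.
    by rewrite fg// gh.
- move=> U c oU x Ux; exists setT, (fun=> c); split=> //; first exact: openT.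
  exact: (regular_cst gX c openT).
- move=> U f g oU rf rg x Ux.
  have [V [f' [oV Vx rf' ff']]] := rf x Ux.
  have [W [g' [oW Wx rg' gg']]] := rg x Ux.
  have oVW : open (V `&` W) by exact: openI.
  exists (V `&` W), (fun y => f' y + g' y); split=> // [|y Uy [Vy Wy]].
    exact: (regular_add gX oVW (regular_sub sX oV oVW (@subIsetl _ _ _) rf')
      (regular_sub sX oW oVW (@subIsetr _ _ _) rg')).
  by rewrite ff'// gg'.
- move=> U f g oU rf rg x Ux.
  have [V [f' [oV Vx rf' ff']]] := rf x Ux.
  have [W [g' [oW Wx rg' gg']]] := rg x Ux.
  have oVW : open (V `&` W) by exact: openI.
  exists (V `&` W), (fun y => f' y * g' y); split=> // [|y Uy [Vy Wy]].
    exact: (regular_mul gX oVW (regular_sub sX oV oVW (@subIsetl _ _ _) rf')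
      (regular_sub sX oW oVW (@subIsetr _ _ _) rg')).
  by rewrite ff'// gg'.
- move=> U f oU rf; apply: open_local => x [Ux fx].
  have [V [g [oV Vx rg fg]]] := rf x Ux.
  exists (U `&` (\val @^-1` [set y | V y /\ g y != 0])); split.
  + apply: openI => //; apply/open_subspace.
    by exists [set y | V y /\ g y != 0]; first exact: (open_neq0 gX).
  + by split=> //=; rewrite -fg.
  + by move=> y [Uy [Vy gy]]; split=> //; rewrite fg.
- move=> U f oU rf x [Ux fx].
  have [V [g [oV Vx rg fg]]] := rf x Ux.
  exists [set y | V y /\ g y != 0], (fun y => (g y)^-1); split.
  + exact: (open_neq0 gX).
  + by split=> //; rewrite -fg.
  + exact: (regular_inv gX).
  + by move=> y [Uy fy] [Vy gy]; rewrite fg.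
Qed.

(** Openness and regularity on the quotient are by definition those of the pullback along the
    projection, so each property reduces to the same property of [X]. *)
Lemma quotient_geometric X (e : equiv_rel X) :
  geometric X -> geometric (quotient_space e).
Proof.
move=> gX; split.
- apply: sheaf_glue => U f oU H; apply/(geometric_sheaf gX) => // x Ux.
  have [V [g [oV Vx rg fg]]] := H _ Ux.
  exists (\pi_({eq_quot e}) @^-1` V), (g \o \pi_({eq_quot e})).
  by split=> // y Uy Vy; apply: fg.
- by move=> U c oU; apply: (regular_cst gX).
- by move=> U f g oU rf rg; apply: (regular_add gX).
- by move=> U f g oU rf rg; apply: (regular_mul gX).
- by move=> U f oU rf; apply: (open_neq0 gX).
- by move=> U f oU rf; apply: (regular_inv gX).
Qed.

(** * Criteria for a map to be a morphism *)

Lemma val_morphism X (A : set X) : morphism (\val : subspace_of A -> X).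
Proof.
split; first exact: initial_continuous.
by move=> V g oV rg x Vx; exists V, g.
Qed.

(** A regular function on [subspace_of A] is locally the restriction of one on [Y], whose pullback
    is regular; the sheaf property of [X] glues these pullbacks. *)
Lemma morphism_subspace X Y (A : set Y) (f : X -> subspace_of A) :
  sheaf_of_functions X -> morphism (\val \o f : X -> Y) -> morphism f.
Proof.
move=> sX mf; split.
  apply/continuousP => U /open_subspace[V oV <-].
  exact: (morphism_open mf oV).
have cf V : open V -> open (f @^-1` V).
  by move=> /open_subspace[W oW <-]; exact: (morphism_open mf oW).
move=> V g oV rg; apply/sX => [|x Vx]; first exact: cf.
have [W [h [oW Wx rh gh]]] := rg _ Vx.
exists ((\val \o f) @^-1` W), (h \o (\val \o f)); split=> //.
- exact: (morphism_open mf oW).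
- by case: mf => _; apply.
- by move=> y Vy Wy; rewrite /= gh.
Qed.

Lemma pi_morphism X (e : equiv_rel X) :
  morphism (\pi_({eq_quot e}) : X -> quotient_space e).
Proof. by split; first exact: pi_continuous. Qed.

Lemma morphism_quotient X Y (e : equiv_rel X) (f : quotient_space e -> Y) :
  morphism (f \o \pi_({eq_quot e}) : X -> Y) -> morphism f.
Proof. by move=> [cf rf]; split=> //; apply/quotient_continuous. Qed.

Lemma mpoly_ring_ind n (K : mpoly n R[i] -> Prop) :
  (forall c, K (mpolyC n c)) -> (forall i, K (mpolyX _ (mnm1 i))) ->
  (forall p q, K p -> K q -> K (p + q)) ->
  (forall p q, K p -> K q -> K (p * q)) -> forall p, K p.
Proof.
move=> KC KX KD KM p.
have K1 : K 1 by rewrite -mpolyC1; apply: (KC).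
have K0 : K 0 by rewrite -mpolyC0; apply: (KC).
rewrite (mpolyE p); apply: (big_ind K K0 KD) => m _.
rewrite -mul_mpolyC; apply: (KM) => //; rewrite mpolyXE_id.
apply: (big_ind K K1 KM) => i _; elim: (m i) => [|k IH]; first by rewrite expr0.
by rewrite exprS; apply: (KM).
Qed.

Lemma regular_meval X n (F : X -> affine_space R n) (P : mpoly n R[i])
    (U : set X) : geometric X -> open U ->
  (forall i, regular U (F ^~ i)) ->
  regular U (fun x => meval (F x) P).
Proof.
move=> gX oU rF; have sX := geometric_sheaf gX.
elim/mpoly_ring_ind: P => [c|i|p q rp rq|p q rp rq].
- by apply: regular_eq (regular_cst gX c oU) => // x _; rewrite mevalC.
- by apply: regular_eq (rF i) => // x _; rewrite mevalXU.
- by apply: regular_eq (regular_add gX oU rp rq) => // x _; rewrite mevalD.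
- by apply: regular_eq (regular_mul gX oU rp rq) => // x _; rewrite mevalM.
Qed.

(** Basic open sets pull back to non-vanishing loci of regular functions, and a local fraction P/Q
    pulls back to a quotient of regular functions. *)
Lemma morphism_affine X n (F : X -> affine_space R n) : geometric X ->
  (forall i, regular setT (F ^~ i)) -> morphism F.
Proof.
move=> gX rF; have sX := geometric_sheaf gX.
have rP P := regular_meval P gX openT rF.
have cF V : open V -> open (F @^-1` V).
  move=> oV; apply: open_local => x Vx.
  have [P Px PV] := zariski_open_basic oV Vx.
  exists [set x | setT x /\ meval (F x) P != 0].
  by split=> // [|y [_ /PV]//]; exact: (open_neq0 gX openT (rP P)).
split=> [|V g oV rg]; first by apply/continuousP.
apply/sX => [|x Vx]; first exact: cF.
have [W [P [Q [oW Wx gPQ]]]] := rg _ Vx.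
have oN := open_neq0 gX openT (rP Q).
pose N := [set x | setT x /\ meval (F x) Q != 0].
have oVN : open (F @^-1` (V `&` W) `&` N) by apply: openI => //; apply/cF/openI.
exists (F @^-1` (V `&` W) `&` N), (fun y => meval (F y) P * (meval (F y) Q)^-1).
split=> //.
- by split=> //; split=> //; have [] := gPQ _ Vx Wx.
- apply: (regular_mul gX oVN).
    by apply: regular_sub (rP P) => //; exact: openT.
  by apply: regular_sub (regular_inv gX openT (rP Q)) => // ? [].
- by move=> y Vy [[_ Wy] _]; have [] := gPQ _ Vy Wy.
Qed.

Lemma regular_coord n i : @regular R (affine_space R n) setT (fun x => x i).
Proof.
move=> x _; exists setT, (mpolyX _ (mnm1 i)), 1; split=> // [|y _ _].
  exact: openT.
by rewrite mevalXU meval1 oner_eq0 divr1.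
Qed.

Lemma morphism_regular X Y (f : X -> Y) (g : Y -> R[i]) :
  morphism f -> regular setT g -> regular setT (g \o f).
Proof. by move=> [_ rf] /(rf _ _ openT); rewrite preimage_setT. Qed.

(** A function on [X] is the pullback along [i] of its pullback along [j], so its regularity can be
    tested on [Y]. *)
Lemma isomorphic_geometric X Y : isomorphic X Y -> geometric Y -> geometric X.
Proof.
move=> [i [j [mi mj iK jK]]] gY.
have ji T (f : X -> T) : f \o j \o i = f by apply: funext => x /=; rewrite iK.
have jiU (U : set X) : i @^-1` (j @^-1` U) = U by apply/seteqP; split=> x /=; rewrite iK.
have rj (U : set X) f : open U -> regular (j @^-1` U) (f \o j) -> regular U f.
  move=> oU /(mi.2 _ _ (morphism_open mj oU)).
  by rewrite jiU ji.
split.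
- apply: sheaf_glue => U f oU H; apply: rj => //.
  apply/(geometric_sheaf gY) => [|y Uy]; first exact: morphism_open.
  have [V [g [oV Vx rg fg]]] := H _ Uy.
  exists (j @^-1` V), (g \o j); split=> //; first exact: morphism_open.
    exact: (mj.2).
  by move=> z; apply: fg.
- by move=> U c oU; apply: rj => //; apply: (regular_cst gY); apply: morphism_open.
- move=> U f g oU rf rg; apply: rj => //; apply: (regular_add gY).
  + exact: morphism_open.
  + exact: mj.2.
  + exact: mj.2.
- move=> U f g oU rf rg; apply: rj => //; apply: (regular_mul gY).
  + exact: morphism_open.
  + exact: mj.2.
  + exact: mj.2.
- move=> U f oU rf.
  have := open_neq0 gY (morphism_open mj oU) (mj.2 _ _ oU rf).
  by move=> /(morphism_open mi); rewrite -[X in _ -> open X]jiU.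
- move=> U f oU rf; have oW := morphism_open mj oU.
  have oV := open_neq0 gY oW (mj.2 _ _ oU rf).
  have := mi.2 _ _ oV (regular_inv gY oW (mj.2 _ _ oU rf)).
  set V' := _ @^-1` _ => rV; suff -> : [set x | U x /\ f x != 0] = V'.
    by have -> : (fun x => (f x)^-1) = (fun y => ((f \o j) y)^-1) \o i
      by apply: funext => x /=; rewrite iK.
  by apply/seteqP; split=> x; rewrite /V' /= iK.
Qed.

(** * A criterion for separatedness *)

Lemma open_neq X (U : set X) f g : geometric X -> open U ->
  regular U f -> regular U g -> open [set x | U x /\ f x != g x].
Proof.
move=> gX oU rf rg.
have := open_neq0 gX oU (regular_add gX oU rf
   (regular_mul gX oU (regular_cst gX (-1) oU) rg)).
congr open; apply/seteqP.
by split=> z /=; rewrite mulN1r subr_eq0.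
Qed.

Lemma affine_variety_geometric X : affine_variety X -> geometric X.
Proof.
move=> [n [C [_ iXC]]]; apply: isomorphic_geometric iXC _.
exact/subspace_geometric/affine_geometric.
Qed.

(** A function that tells [f z] from [g z] pulls back along [f] and [g] to two regular functions
    near [z]; the locus where these differ is open and misses the coincidence set. *)
Lemma separated_of_functions X :
  (forall x y : X, x <> y -> exists (U : set X) (f : X -> R[i]),
     [/\ open U, U x, U y, regular U f & f x != f y]) ->
  Defs.separated X.
Proof.
move=> H Z f g aZ mf mg; rewrite -openC; apply: open_local => z /= fgz.
have [U [h [oU Ufz Ugz rh hfg]]] := H _ _ fgz.
have oW : open (f @^-1` U `&` g @^-1` U).
  by apply: openI; apply: morphism_open.
exists [set y | (f @^-1` U `&` g @^-1` U) y /\ (h \o f) y != (h \o g) y].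
split=> //; last by move=> y [_] /= /eqP + E; rewrite E.
have gZ := affine_variety_geometric aZ; have sZ := geometric_sheaf gZ.
have oV := morphism_open mf oU; have oV' := morphism_open mg oU.
apply: (open_neq gZ oW).
  exact: (regular_sub sZ oV oW (@subIsetl _ _ _) (mf.2 _ _ oU rh)).
exact: (regular_sub sZ oV' oW (@subIsetr _ _ _) (mg.2 _ _ oU rh)).
Qed.

End Funspaces.

(** * Points in coordinates, and maps given by polynomials or fractions *)

Section PolynomialMaps.
Variable R : realType.

Definition affpt n (s : seq R[i]) : affine_space R n := fun i => nth 0 s i.
Arguments affpt n s : clear implicits.

Definition coord_poly n k (lt_kn : (k < n)%N) : mpoly n R[i] :=
  mpolyX _ (mnm1 (Ordinal lt_kn)).

Lemma affpt2E (v : affine_space R 2) :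
  v = affpt 2 [:: v (@Ordinal 2 0 isT); v (@Ordinal 2 1 isT)].
Proof.
by apply/funext; case=> -[|[|//]] ?; rewrite /affpt /=; congr v; apply: val_inj.
Qed.

Lemma affpt3E (v : affine_space R 3) :
  v = affpt 3 [:: v (@Ordinal 3 0 isT); v (@Ordinal 3 1 isT); v (@Ordinal 3 2 isT)].
Proof.
by apply/funext; case=> -[|[|[|//]]] ?; rewrite /affpt /=; congr v; apply: val_inj.
Qed.

Lemma affpt4E (v : affine_space R 4) :
  v = affpt 4 [:: v (@Ordinal 4 0 isT); v (@Ordinal 4 1 isT);
                v (@Ordinal 4 2 isT); v (@Ordinal 4 3 isT)].
Proof.
by apply/funext; case=> -[|[|[|[|//]]]] ?; rewrite /affpt /=; congr v; apply: val_inj.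
Qed.

Lemma polynomial_map_morphism n m (A : set (affine_space R n))
    (P : 'I_m -> mpoly n R[i]) :
  morphism (fun x : subspace_of A => (fun i => meval (\val x) (P i)) : affine_space R m).
Proof.
have gA := subspace_geometric A (affine_geometric R n).
apply: morphism_affine => // i; apply: regular_meval => // [|j].
  exact: openT.
exact: (morphism_regular (val_morphism A) (@regular_coord R n j)).
Qed.

(** The identity is asked for all z, also where [G z] is outside [U] and the values of f are
    arbitrary. This makes continuity a consequence, by taking for f the indicator function of
    [U]. *)
Lemma morphism_of_fractions n (A : set (affine_space R n)) (X : funspace R)
    (G : subspace_of A -> X) : geometric X ->
  (forall (U : set X) f z0, open U -> regular U f -> U (G z0) ->
     exists H K : mpoly n R[i], meval (\val z0) H != 0 /\
       forall z, f (G z) * meval (\val z) H = meval (\val z) K) ->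
  morphism G.
Proof.
move=> gX frac.
have gA := subspace_geometric A (affine_geometric R n).
have oP (P : mpoly n R[i]) : open [set z : subspace_of A | meval (\val z) P != 0].
  exact: (morphism_open (val_morphism A) (zariski_open_meval P)).
have rP (P : mpoly n R[i]) (U : set (subspace_of A)) : open U ->
    regular U (fun z => meval (\val z) P).
  move=> oU; apply: (regular_sub (geometric_sheaf gA) openT oU (@subsetT _ _)).
  apply: regular_meval => // [|j]; first exact: openT.
  exact: (morphism_regular (val_morphism A) (@regular_coord R n j)).
have cG (U : set X) : open U -> open (G @^-1` U).
  move=> oU; apply: open_local => z0 Uz0.
  (* The indicator function is regular on [U], being 1 there; the resulting [K] is nonzero at [z0]
     and vanishes outside the preimage of [U]. *)
  have r1 : regular U (fun x => if x \in U then 1 else 0).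
    apply: regular_eq (regular_cst gX 1 oU) => //; first exact: geometric_sheaf.
    by move=> x Ux; rewrite mem_set.
  have [H [K [Hz0 HK]]] := frac _ _ z0 oU r1 Uz0.
  exists [set z : subspace_of A | meval (\val z) K != 0]; split=> //.
    by rewrite /= -HK mem_set// mul1r.
  move=> z /=; rewrite -HK; case: ifPn => [/set_mem//|_].
  by rewrite mul0r eqxx.
split=> [|U f oU rf]; first by apply/continuousP.
apply/(geometric_sheaf gA) => [|z0 Uz0]; first exact: cG.
have [H [K [Hz0 HK]]] := frac _ _ z0 oU rf Uz0.
exists [set z : subspace_of A | meval (\val z) H != 0].
exists (fun z => meval (\val z) K * (meval (\val z) H)^-1); split=> //.
  apply: (regular_mul gA) => //; first exact: rP.
  have /(regular_inv gA openT) := rP H _ openT.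
  by congr regular; apply/seteqP; split=> z /= ; [case|].
by move=> z _ Hz; rewrite -HK mulfK.
Qed.

End PolynomialMaps.

Arguments affpt {R} n s.

(** * The weighted projective plane *)

Section WeightedPlane.
Variable R : realType.
Local Notation C := R[i].
Local Notation punct := (punctured_space R 3).
Local Notation Q := (weighted_projective_space R weights112).
Local Notation X0 := (@coord_poly R 3 0 isT).
Local Notation X1 := (@coord_poly R 3 1 isT).
Local Notation X2 := (@coord_poly R 3 2 isT).

Definition toQ (u : punct) : Q := \pi_({eq_quot (weighted_orbit_equiv R weights112)}) u.

Lemma toQ_surj q : exists u, q = toQ u.
Proof. by exists (repr q); rewrite /toQ reprK. Qed.

Lemma toQP (u v : punct) : toQ u = toQ v <->
  exists2 l : C, l != 0 & forall i, \val v i = l ^+ weights112 i * \val u i.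
Proof.
split=> [/eqmodP /asboolP//|H]; apply/eqmodP; exact/asboolP.
Qed.

Lemma geometric_Q : geometric Q.
Proof. exact/quotient_geometric/subspace_geometric/affine_geometric. Qed.

Lemma toQ_morphism : morphism (toQ).
Proof. exact: pi_morphism. Qed.

(** Weighted homogeneity of degree 2 for the weights 1, 1, 2. *)
Definition form (P : mpoly 3 C) := forall (l x y z : C),
  meval (affpt 3 [:: l * x; l * y; l ^+ 2 * z]) P = l ^+ 2 * meval (affpt 3 [:: x; y; z]) P.

(** One factor serves all forms, so it cancels in their ratios. *)
Lemma form_toQ (u v : punct) : toQ u = toQ v ->
  exists2 l : C, l != 0 & forall P, form P ->
    meval (\val v) P = l * meval (\val u) P.
Proof.
move=> /toQP[l l0 uv]; exists (l ^+ 2); first by rewrite expf_neq0.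
move=> P fP; rewrite (affpt3E (\val v)) !uv (affpt3E (\val u)) /= !expr1.
exact: fP.
Qed.

Lemma formD P P' : form P -> form P' -> form (P + P').
Proof. by move=> fP fP' l x y z; rewrite !mevalD fP fP' mulrDr. Qed.

(** The monomials of weighted degree 2. Beyond index 3 the value is the default 0, again a form, so
    [k] can range over all of [nat]. *)
Definition monomial2 (k : nat) : mpoly 3 C :=
  nth 0 [:: X0 * X0; X0 * X1; X1 * X1; X2] k.

Lemma meval_coord_poly n k (h : (k < n)%N) (s : seq C) :
  meval (affpt n s) (coord_poly R h) = s`_k.
Proof. by rewrite mevalXU. Qed.

Lemma meval_monomial2 (x y z : C) k :
  meval (affpt 3 [:: x; y; z]) (monomial2 k) = [:: x * x; x * y; y * y; z]`_k.
Proof.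
case: k => [|[|[|[|k]]]]; rewrite /monomial2 /=.
- by rewrite mevalM meval_coord_poly.
- by rewrite mevalM !meval_coord_poly.
- by rewrite mevalM meval_coord_poly.
- by rewrite meval_coord_poly.
- by rewrite !nth_nil meval0.
Qed.

Lemma form_monomial2 k : form (monomial2 k).
Proof.
move=> l x y z; rewrite !meval_monomial2.
by case: k => [|[|[|[|k]]]] /=; rewrite ?nth_nil ?mulr0//; ring.
Qed.

(* Meaningful only for forms [P] and [G], as [repr] picks some representative. *)
Definition ratio (P G : mpoly 3 C) (q : Q) : C :=
  meval (\val (repr q)) P / meval (\val (repr q)) G.

Definition chart (G : mpoly 3 C) : set Q :=
  [set q | meval (\val (repr q)) G != 0].

Lemma toQ_repr (q : Q) : toQ (repr q) = q.
Proof. by rewrite /toQ reprK. Qed.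

Lemma ratio_toQ P G u : form P -> form G ->
  ratio P G (toQ u) = meval (\val u) P / meval (\val u) G.
Proof.
move=> fP fG; have [l l0 lE] := form_toQ (toQ_repr (toQ u)).
by rewrite (lE P)// (lE G)// -mulf_div divff// mul1r.
Qed.

Lemma chart_toQ G u : form G -> chart G (toQ u) <-> meval (\val u) G != 0.
Proof.
move=> fG; have [l l0 lE] := form_toQ (toQ_repr (toQ u)).
by rewrite (lE G)// /chart /= mulf_eq0 (negbTE l0).
Qed.

Lemma toQ_chart G : form G -> toQ @^-1` chart G = [set u | meval (\val u) G != 0].
Proof. by move=> fG; apply/seteqP; split=> u /chart_toQ; apply. Qed.

Lemma open_chart G : form G -> open (chart G).
Proof.
move=> fG; have : open (toQ @^-1` chart G); last by [].
rewrite toQ_chart//; exact: (morphism_open (val_morphism _) (zariski_open_meval G)).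
Qed.

Lemma geometric_punct : geometric punct.
Proof. exact/subspace_geometric/affine_geometric. Qed.

Lemma regular_punct_meval (U : set punct) P : open U ->
  regular U (fun u => meval (\val u) P).
Proof.
move=> oU; apply: (regular_meval _ geometric_punct) => // j.
apply: (regular_sub (geometric_sheaf geometric_punct) openT oU (@subsetT _ _)).
exact: (morphism_regular (val_morphism _) (@regular_coord R 3 j)).
Qed.

Lemma regular_ratio P G : form P -> form G -> regular (chart G) (ratio P G).
Proof.
move=> fP fG.
have gU := geometric_punct.
have oU : open (toQ @^-1` chart G) := open_chart fG.
have : regular (toQ @^-1` chart G) (ratio P G \o toQ); last by [].
have -> : ratio P G \o toQ = fun u => meval (\val u) P * (meval (\val u) G)^-1.
  by apply: funext => u; rewrite /= ratio_toQ.
apply: (regular_mul gU) => //; first exact: regular_punct_meval.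
have := regular_inv gU openT (regular_punct_meval G openT).
by rewrite toQ_chart//; congr regular; apply/seteqP; split=> u /=; [case|].
Qed.

Lemma punctP (v : affine_space R 3) :
  (exists i, v i != 0) -> v \in ~` [set (fun=> 0) : affine_space R 3].
Proof. by move=> [i /eqP vi]; rewrite inE => v0; apply: vi; rewrite v0. Qed.

Definition mkpunct (v : affine_space R 3) (h : exists i, v i != 0) : punct :=
  exist _ v (punctP h).

Lemma punct_neq0 (u : punct) : exists k, meval (\val u) (monomial2 k) != 0.
Proof.
apply: contrapT => /forallNP H.
have Z k : meval (\val u) (monomial2 k) = 0 by apply/eqP/negPn/negP/H.
have := set_valP u; apply.
move: (Z 0) (Z 2) (Z 3).
rewrite (affpt3E (\val u)) !meval_monomial2/= => /eqP + /eqP + z.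
rewrite !mulf_eq0 !orbb => /eqP -> /eqP ->; rewrite z.
by apply: funext; case=> -[|[|[|//]]].
Qed.

(** The scalar sought is a square root l of c with x' = lx and y' = ly. If x is nonzero it is x'/x,
    where xx' gives the square and xy gives y'; if x = 0 and y is nonzero it is y'/y; if both
    vanish, any square root of c works. *)
Lemma monomial2_inj (c : C) (u v : punct) : c != 0 ->
  (forall k, meval (\val v) (monomial2 k) = c * meval (\val u) (monomial2 k)) ->
  toQ u = toQ v.
Proof.
move=> c0 H; apply/toQP.
move: (H 0%N) (H 1%N) (H 2%N) (H 3%N) => {H}.
rewrite (affpt3E (\val u)) (affpt3E (\val v)) !meval_monomial2/=.
move: (\val u _) (\val u _) (\val u _) (\val v _) (\val v _) (\val v _).
move=> z y x z' y' x' xx xy yy zz.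
suff [l l0 [lx ly lz]] : exists2 l : C, l != 0 &
    [/\ x' = l * x, y' = l * y & z' = l ^+ 2 * z].
  by exists l => //; case=> -[|[|[|//]]] ?; rewrite /affpt /weights112 /= ?expr1.
have [x0|x0] := eqVneq x 0.
  rewrite x0 !(mul0r, mulr0) in xx xy *.
  move/eqP: xx; rewrite mulf_eq0 orbb => /eqP ->.
  have [y0|y0] := eqVneq y 0.
    rewrite y0 !mulr0 in yy *; move/eqP: yy; rewrite mulf_eq0 orbb => /eqP ->.
    by exists (sqrtC c); rewrite ?sqrtC_eq0// sqrtCK !mulr0.
  have y'0 : y' != 0.
    apply: contraNneq y0 => y'0; rewrite y'0 mul0r in yy; move/esym/eqP: yy.
    by rewrite !mulf_eq0 (negbTE c0) orbb.
  exists (y' / y); first by rewrite mulf_neq0 ?invr_eq0.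
  split; [by rewrite mulr0|by rewrite divfK|].
  by rewrite zz; congr (_ * _); rewrite expr2 mulf_div yy mulfK// mulf_neq0.
have x'0 : x' != 0.
  apply: contraNneq x0 => x'0; rewrite x'0 mul0r in xx; move/esym/eqP: xx.
  by rewrite !mulf_eq0 (negbTE c0) orbb.
have cE : (x' / x) ^+ 2 = c by rewrite expr2 mulf_div xx mulfK// mulf_neq0.
exists (x' / x); first by rewrite mulf_neq0 ?invr_eq0.
split; [by rewrite divfK| |by rewrite cE].
apply: (mulfI x'0); rewrite xy -cE; field.
exact: x0.
Qed.

Lemma separated_Q : Defs.separated Q.
Proof.
apply: separated_of_functions => p q.
have [u ->] := toQ_surj p; have [v ->] := toQ_surj q => {p q} uv.
have fM := form_monomial2.
suff [G [F [fG fF Gu Gv FG]]] : exists G F, [/\ form G, form F,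
    meval (\val u) G != 0, meval (\val v) G != 0 &
    meval (\val u) F / meval (\val u) G != meval (\val v) F / meval (\val v) G].
  exists (chart G), (ratio F G); rewrite !ratio_toQ//.
  split=> //; [exact: open_chart|exact/chart_toQ|exact/chart_toQ|exact: regular_ratio].
pose M i (w : punct) := meval (\val w) (monomial2 i).
(* If some monomial is nonzero at both points, it serves as denominator. *)
have [[i Miu Miv]|noi] := pselect (exists2 i, M i u != 0 & M i v != 0).
  have [[k Hk]|nok] := pselect (exists k, M k u / M i u != M k v / M i v).
    by exists (monomial2 i), (monomial2 k).
  (* All ratios agree, so the values at [v] are proportional to those at [u], and the two points
     coincide. *)
  case: uv; apply: (@monomial2_inj (M i v / M i u)).
    by rewrite mulf_neq0// invr_eq0.
  move=> k; have := contrapT (fun h => nok (ex_intro _ k (introN idP h))).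
  rewrite -!/(M _ _) eqr_div// => /eqP E.
  by apply: (mulIf Miu); rewrite -E [RHS]mulrAC divfK// mulrC.
have [i Miu] := punct_neq0 u; have [j Mjv] := punct_neq0 v.
have Miv : M i v = 0 by apply/eqP/negPn/negP => h; apply: noi; exists i.
have Mju : M j u = 0 by apply/eqP/negPn/negP => h; apply: noi; exists j.
(* The sum is nonzero at both points, and the ratio is 1 at [u] and 0 at [v]. *)
exists (monomial2 i + monomial2 j), (monomial2 i).
rewrite !mevalD -!/(M _ _) Miv Mju addr0 add0r mul0r divff//.
by split=> //; [exact: formD|exact: oner_neq0].
Qed.

(** The inverse of [g] has the ratios [ratio (F i) G] as coordinates; they land in [Z] because every
    point of the chart is some [g z]. *)
Lemma affine_chart n (G : mpoly 3 C) (F : 'I_n -> mpoly 3 C)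
    (Z : set (affine_space R n)) (g : subspace_of Z -> Q) :
  form G -> (forall i, form (F i)) -> closed Z -> morphism g ->
  (forall z, chart G (g z)) ->
  (forall z i, ratio (F i) G (g z) = \val z i) ->
  (forall q, chart G q -> exists z, g z = q) ->
  affine_variety (subspace_of (chart G)).
Proof.
move=> fG fF cZ mg gG Fg gsurj; exists n, Z; split=> //.
have gQG : geometric (subspace_of (chart G)) := subspace_geometric _ geometric_Q.
have FZ (q : subspace_of (chart G)) :
    ((fun i => ratio (F i) G (\val q)) : affine_space R n) \in Z.
  have [z zq] := gsurj _ (set_valP q).
  suff -> : (fun i => ratio (F i) G (\val q)) = \val z :> affine_space R n by exact: valP.
  by apply: funext => i; rewrite -zq Fg.
pose f (q : subspace_of (chart G)) : subspace_of Z :=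
  @exist (affine_space R n) (fun x => x \in Z) _ (FZ q).
pose g' (z : subspace_of Z) : subspace_of (chart G) :=
  @exist Q (fun x => x \in chart G) _ (mem_set (gG z)).
have g'K : cancel g' f.
  by move=> z; apply: val_inj; apply: funext => i; exact: Fg.
exists f, g'; split=> //.
- apply: morphism_subspace; first exact: geometric_sheaf.
  apply: morphism_affine => // i.
  have := (val_morphism (chart G)).2 _ _ (open_chart fG) (regular_ratio (fF i) fG).
  by congr regular; apply/seteqP; split=> // q _; exact: set_valP.
- apply: morphism_subspace => //.
  exact/geometric_sheaf/subspace_geometric/affine_geometric.
- move=> q; have [z zq] := gsurj _ (set_valP q).
  have -> : q = g' z by apply: val_inj.
  by rewrite g'K.
Qed.

End WeightedPlane.

(** * The three affine charts of the weighted plane *)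

Section Charts.
Variable R : realType.
Local Notation C := R[i].
Local Notation punct := (punctured_space R 3).
Local Notation Q := (weighted_projective_space R weights112).

(** A local fraction becomes a global identity on multiplying numerator and denominator by a
    polynomial [E] that is nonzero at x and vanishes outside a small neighbourhood, where both sides
    are then 0. *)
Lemma regular_fraction n (A : set (affine_space R n)) (U : set (subspace_of A)) f x :
  open U -> regular U f -> U x ->
  exists P D : mpoly n C, meval (\val x) D != 0 /\
    forall y, f y * meval (\val y) D = meval (\val y) P.
Proof.
move=> oU rf Ux; have [V [g [oV Vx rg fg]]] := rf x Ux.
have [W [P [D [oW Wx gPD]]]] := rg _ Vx.
have [U' oU' U'U] := (open_subspace U).1 oU.
have U'x : U' (\val x) by rewrite -U'U in Ux.
have oN := openI oU' (openI oV oW).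
have [E Ex EN] := zariski_open_basic oN (conj U'x (conj Vx Wx)).
exists (P * E), (D * E); split=> [|y].
  by rewrite mevalM mulf_neq0//; have [] := gPD _ Vx Wx.
rewrite !mevalM; have [->|Ey] := eqVneq (meval (\val y) E) 0.
  by rewrite !mulr0.
have [U'y [Vy Wy]] := EN _ Ey.
have Uy : U y by rewrite -U'U.
by rewrite fg//; have [Dy ->] := gPD _ Vy Wy; rewrite mulrA divfK.
Qed.

Lemma toQ_polynomial_morphism n (A : set (affine_space R n))
    (P : 'I_3 -> mpoly n C)
    (nz : forall x : subspace_of A, exists i, meval (\val x) (P i) != 0) :
  morphism ((fun x => toQ (mkpunct (nz x))) : subspace_of A -> Q).
Proof.
apply: (@morphism_comp R _ _ _ (fun x => mkpunct (nz x)) (@toQ R)); last exact: toQ_morphism.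
apply: morphism_subspace; last exact: polynomial_map_morphism.
exact/geometric_sheaf/subspace_geometric/affine_geometric.
Qed.

(* [b] selects the chart y <> 0, as opposed to x <> 0. *)
Lemma affine_chart_square (b : bool) :
  affine_variety (subspace_of (chart (monomial2 R (if b then 2 else 0)%N))).
Proof.
have fM := @form_monomial2 R.
pose Z : set (affine_space R 2) := setT.
pose Y0 := coord_poly R (isT : 0 < 2)%N; pose Y1 := coord_poly R (isT : 1 < 2)%N.
pose P (i : 'I_3) : mpoly 2 C := (if b then [:: Y0; 1; Y1] else [:: 1; Y0; Y1])`_i.
pose sec (s t : C) := affpt 3 (if b then [:: s; 1; t] else [:: 1; s; t]).
have PE (v : affine_space R 2) : (fun i => meval v (P i)) =
    sec (v (@Ordinal 2 0 isT)) (v (@Ordinal 2 1 isT)).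
  by rewrite [LHS]affpt3E /P /sec; case: (b); rewrite /= meval1 !mevalXU.
have nz (x : subspace_of Z) : exists i, meval (\val x) (P i) != 0.
  exists (if b then @Ordinal 3 1 isT else @Ordinal 3 0 isT).
  by rewrite /P; case: (b); rewrite /= meval1 oner_neq0.
have uE z : \val (mkpunct (nz z)) =
    sec (\val z (@Ordinal 2 0 isT)) (\val z (@Ordinal 2 1 isT)) := PE (\val z).
(* The coordinates are xy/x^2 = y/x and z/x^2 on x <> 0, and xy/y^2 = x/y and z/y^2 on y <> 0. *)
pose F (i : 'I_2) := monomial2 R (nth 0%N [:: 1; 3]%N i).
apply: (@affine_chart R 2 _ F Z _ (fM _) _ _ (toQ_polynomial_morphism nz)).
- by move=> i; apply: fM.
- exact: closedT.
- move=> z; apply/chart_toQ => //; rewrite uE /sec.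
  by case: (b); rewrite meval_monomial2/= mul1r oner_neq0.
- move=> z i; rewrite ratio_toQ; [|exact: fM|exact: fM].
  rewrite uE /sec [in RHS](affpt2E (\val z)).
  case: (b); rewrite !meval_monomial2/= ?mul1r ?mulr1 divr1;
    by case: i => -[|[|//]] ? /=; rewrite ?mul1r ?mulr1.
- move=> q; have [u ->] := toQ_surj q => /(chart_toQ _ (fM _)).
  rewrite (affpt3E (\val u)) meval_monomial2.
  pose x := \val u (if b then @Ordinal 3 1 isT else @Ordinal 3 0 isT).
  pose y := \val u (if b then @Ordinal 3 0 isT else @Ordinal 3 1 isT).
  move=> xx; have {xx} x0 : x != 0.
    by move: xx; rewrite /x; case: (b); rewrite /= mulf_eq0 orbb.
  (* Here [x] is the nonzero coordinate of [u]; scaling by its inverse normalizes it to 1. *)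
  pose v := affpt 2 [:: y / x; \val u (@Ordinal 3 2 isT) / x ^+ 2].
  exists (@exist _ (fun w => w \in Z) v (in_setT v)); apply/toQP.
  exists x => // i; rewrite uE /sec (affpt3E (\val u)) /v /y.
  move: x0; rewrite /x; case: (b) => x0;
    case: i => -[|[|[|//]]] ?; rewrite /affpt /weights112 /= ?expr1 ?mulr1//;
    by rewrite mulrC divfK// expf_neq0.
Qed.

(** * The chart z <> 0 and the quadratic cone *)

Lemma slice_neq0 (a b : C) : exists i, affpt 3 [:: a; b; 1] i != 0.
Proof. by exists (@Ordinal 3 2 isT); exact: oner_neq0. Qed.

Definition slice (a b : C) : Q := toQ (mkpunct (slice_neq0 a b)).

Lemma sliceN a b : slice (- a) (- b) = slice a b.
Proof.
apply/toQP; exists (-1); first by rewrite oppr_eq0 oner_neq0.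
by case=> -[|[|[|//]]] ?; rewrite /affpt /weights112 /= ?expr1 ?mulN1r ?opprK//
  sqrrN expr1n mul1r.
Qed.

Definition veronese (a b : C) : affine_space R 3 := affpt 3 [:: a * a; a * b; b * b].

(** Even polynomials in a, b are polynomials in a^2, ab, b^2, and odd ones are combinations of a and
    b with even coefficients. A product of two odd parts is even, so the shape is stable under
    products. *)
Lemma parity_decomposition (P : mpoly 3 C) : exists E H K : mpoly 3 C, forall a b,
  meval (affpt 3 [:: a; b; 1]) P = meval (veronese a b) E
    + (a * meval (veronese a b) H + b * meval (veronese a b) K).
Proof.
elim/mpoly_ring_ind: P => [c|i|p q [E [H [K pE]]] [E' [H' [K' qE]]]
  |p q [E [H [K pE]]] [E' [H' [K' qE]]]].
- by exists (mpolyC 3 c), 0, 0 => a b; rewrite !mevalC !mulr0 !addr0.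
- case: i => -[|[|[|//]]] ?.
  + by exists 0, 1, 0 => a b; rewrite mevalXU !meval0 meval1 mulr0 mulr1 addr0 add0r.
  + by exists 0, 0, 1 => a b; rewrite mevalXU !meval0 meval1 mulr0 mulr1 !add0r.
  + by exists 1, 0, 0 => a b; rewrite mevalXU !meval0 meval1 !mulr0 !addr0.
- by exists (E + E'), (H + H'), (K + K') => a b; rewrite !mevalD pE qE; ring.
- pose V k (h : (k < 3)%N) := coord_poly R h.
  exists (E * E' + (V 0%N isT * (H * H') + V 1%N isT * (H * K' + K * H')
      + V 2%N isT * (K * K'))),
    (E * H' + H * E'), (E * K' + K * E') => a b.
  by rewrite !(mevalD, mevalM) pE qE /V !meval_coord_poly /=; ring.
Qed.

(* As psi is even, psi D = P splits into the even and the odd parts; where the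
   even part of D vanishes, multiply the odd equation by the odd part of D. *)
Lemma even_fraction (psi : C -> C -> C) (P D : mpoly 3 C) a0 b0 :
  (forall a b, psi (- a) (- b) = psi a b) ->
  (forall a b, psi a b * meval (affpt 3 [:: a; b; 1]) D
     = meval (affpt 3 [:: a; b; 1]) P) ->
  meval (affpt 3 [:: a0; b0; 1]) D != 0 ->
  exists H K : mpoly 3 C, meval (veronese a0 b0) H != 0 /\
    forall a b, psi a b * meval (veronese a b) H = meval (veronese a b) K.
Proof.
move=> psiN psiE.
have [E [H [K PE]]] := parity_decomposition P.
have [E' [H' [K' DE]]] := parity_decomposition D.
have veroneseN a b : veronese (- a) (- b) = veronese a b by rewrite /veronese !mulrNN.
pose o a b (A B : mpoly 3 C) := a * meval (veronese a b) A + b * meval (veronese a b) B.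
have psi_odd a b : psi a b * o a b H' K' = o a b H K.
  (* The equations at (a, b) and (-a, -b) differ by twice the odd one. *)
  have := psiE a b; have := psiE (- a) (- b); rewrite psiN !PE !DE veroneseN /o => e1 e2.
  apply: (@mulfI _ 2); first by rewrite pnatr_eq0.
  transitivity (psi a b * (meval (veronese a b) E' +
      (a * meval (veronese a b) H' + b * meval (veronese a b) K')) -
    psi a b * (meval (veronese a b) E' +
      (- a * meval (veronese a b) H' + - b * meval (veronese a b) K'))).
    by ring.
  by rewrite e1 e2; ring.
have psi_even a b : psi a b * meval (veronese a b) E' = meval (veronese a b) E.
  apply: (addIr (psi a b * o a b H' K')).
  by rewrite {2}psi_odd -mulrDr -DE psiE PE.
rewrite DE; have [->|E'0 _] := eqVneq (meval (veronese a0 b0) E') 0; last by exists E', E.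
rewrite add0r => O'0.
pose V k (h : (k < 3)%N) := coord_poly R h.
(* The product of aA + bB and aA' + bB', written in a^2, ab, b^2. *)
pose prod A B A' B' := V 0%N isT * (A * A') + V 1%N isT * (A * B' + B * A')
  + V 2%N isT * (B * B').
have prodE a b A B A' B' :
    meval (veronese a b) (prod A B A' B') = o a b A B * o a b A' B'.
  by rewrite /prod !(mevalD, mevalM) /V !meval_coord_poly /o /=; ring.
exists (prod H' K' H' K'), (prod H K H' K'); split=> [|a b].
  by rewrite prodE mulf_neq0.
by rewrite !prodE mulrA psi_odd.
Qed.

(** A point of the cone is sent to [slice a b] for a chosen preimage (a, b) under [veronese]. The
    choice itself need not be algebraic, but a regular function composed with [slice] is even in (a,
    b), hence locally a fraction in the coordinates of the cone. *)
Lemma affine_chart_cone : affine_variety (subspace_of (chart (monomial2 R 3))).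
Proof.
have fM := @form_monomial2 R.
pose V k (h : (k < 3)%N) := coord_poly R h.
pose Z : set (affine_space R 3) :=
  zero_locus [set V 0%N isT * V 2%N isT - V 1%N isT * V 1%N isT].
have ZE x y z : Z (affpt 3 [:: x; y; z]) <-> x * z = y * y.
  split=> [/(_ _ erefl)/eqP|xz P ->]; rewrite mevalB !mevalM /V !meval_coord_poly /=.
    by rewrite subr_eq0 => /eqP.
  by rewrite xz subrr.
have cZ : closed Z.
  by rewrite -openC; exists [set V 0%N isT * V 2%N isT - V 1%N isT * V 1%N isT]; rewrite setCK.
have root (z : subspace_of Z) : exists ab : C * C, \val z = veronese ab.1 ab.2.
  have := set_valP z; rewrite (affpt3E (\val z)).
  move: (\val z _) (\val z _) (\val z _) => w v u /ZE uw.
  (* On uw = v^2, u = 0 forces v = 0, and a = 0 with b a square root of w works; otherwise a is a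
     square root of u and b = v/a. *)
  have [u0|u0] := eqVneq u 0.
    exists (0, sqrtC w); rewrite /veronese /= !mul0r -expr2 sqrtCK u0.
    by move/esym/eqP: uw; rewrite u0 mul0r mulf_eq0 orbb => /eqP ->.
  have s0 : sqrtC u != 0 by rewrite sqrtC_eq0.
  exists (sqrtC u, v / sqrtC u); rewrite /veronese /=.
  have ss : sqrtC u * sqrtC u = u by rewrite -expr2 sqrtCK.
  by rewrite mulf_div ss [sqrtC u * _]mulrC divfK// -uw [u * w]mulrC mulfK.
have [r rE] := choice root.
pose g (z : subspace_of Z) : Q := slice (r z).1 (r z).2.
pose F (i : 'I_3) := monomial2 R i.
apply: (@affine_chart R 3 _ F Z g (fM 3)) => //.
- by move=> i; apply: fM.
- apply: morphism_of_fractions => [|U f z0 oU rf Uz0]; first exact: geometric_Q.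
  have [|P [D [D0 PD]]] := @regular_fraction _ _ (@toQ R @^-1` U) (f \o @toQ R)
    (mkpunct (slice_neq0 (r z0).1 (r z0).2)) _ rf Uz0; first exact: oU.
  have [|||H [K [H0 HK]]] := @even_fraction (fun a b => f (slice a b)) P D (r z0).1 (r z0).2.
  + by move=> a b; rewrite sliceN.
  + by move=> a b; apply: (PD (mkpunct (slice_neq0 a b))).
  + exact: D0.
  by exists H, K; rewrite rE; split=> // z; rewrite rE; apply: HK.
- by move=> z; apply/chart_toQ => //=; rewrite meval_monomial2/= oner_neq0.
- move=> z i; rewrite ratio_toQ /=; [|exact: fM|exact: fM].
  rewrite !meval_monomial2/= divr1 rE.
  by case: i => -[|[|[|//]]].
- move=> q; have [u ->] := toQ_surj q => /(chart_toQ _ (fM _)).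
  have [x [y [w uE]]] : exists x y w, \val u = affpt 3 [:: x; y; w].
    by do 3 eexists; exact: affpt3E.
  rewrite uE meval_monomial2/= => w0.
  have zZ : affpt 3 [:: x * x / w; x * y / w; y * y / w] \in Z.
    by apply/mem_set/ZE; rewrite !mulf_div [x * y * _]mulrACA.
  exists (@exist _ (fun v => v \in Z) _ zZ).
  have := rE (@exist _ (fun v => v \in Z) _ zZ); rewrite /g /=.
  case: (r _) => a b /= sE.
  move: (congr1 (@^~ (@Ordinal 3 0 isT)) sE) (congr1 (@^~ (@Ordinal 3 1 isT)) sE)
    (congr1 (@^~ (@Ordinal 3 2 isT)) sE).
  rewrite /veronese /affpt /= => e0 e1 e2.
  (* The monomials of [u] are [w] times those of (a, b, 1), which avoids matching a square root of
     [w] with the chosen (a, b). *)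
  apply: (@monomial2_inj _ w) => // k.
  rewrite uE !meval_monomial2 -e0 -e1 -e2.
  by case: k => [|[|[|[|k]]]] /=; rewrite ?nth_nil ?mulr0 ?mulr1// [RHS]mulrC divfK.
Qed.

Lemma variety_Q : variety Q.
Proof.
split; [exact/geometric_sheaf/geometric_Q| |exact: separated_Q].
have fM := @form_monomial2 R.
(* Index 1 is left out: the chart of xy lies in that of x^2. *)
exists 3, (fun i : 'I_3 => chart (monomial2 R (nth 0%N [:: 0; 2; 3]%N i))); split.
  move=> i; split; first exact: open_chart.
  case: i => -[|[|[|//]]] ? /=.
  - exact: (affine_chart_square false).
  - exact: (affine_chart_square true).
  - exact: affine_chart_cone.
apply/seteqP; split=> // q _; have [u ->] := toQ_surj q.
have [k uk] := punct_neq0 u.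
have [j uj] : exists j : 'I_3, meval (\val u) (monomial2 R (nth 0%N [:: 0; 2; 3]%N j)) != 0.
  move: uk; rewrite (affpt3E (\val u)) !meval_monomial2.
  case: k => [|[|[|[|k]]]] /= => [uk|||uk|]; last by rewrite nth_nil eqxx.
  - by exists (@Ordinal 3 0 isT); rewrite meval_monomial2.
  - rewrite mulf_eq0 => /norP[x0 _]; exists (@Ordinal 3 0 isT).
    by rewrite meval_monomial2 /= mulf_neq0.
  - by move=> uk; exists (@Ordinal 3 1 isT); rewrite meval_monomial2.
  - by exists (@Ordinal 3 2 isT); rewrite meval_monomial2.
by exists j => //; apply/chart_toQ.
Qed.

End Charts.

(** * The quotient map *)

Section Semistable.
Variable R : realType.
Local Notation C := R[i].
Local Notation punct := (punctured_space R 3).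
Local Notation Q := (weighted_projective_space R weights112).
Local Notation Vss := (semistable_locus R matrixA alpha20).

Lemma torus_of_neq0 (a b : C) : a != 0 -> b != 0 -> exists t : torus R 2,
  sval t (@Ordinal 2 0 isT) = a /\ sval t (@Ordinal 2 1 isT) = b.
Proof.
move=> a0 b0; have h i : affpt 2 [:: a; b] i != 0 by case: i => -[|[|//]].
by exists (exist _ (affpt 2 [:: a; b] : 'I_2 -> C) h).
Qed.

Lemma torus_act_matrixA (t : torus R 2) (a b x y z w : C) :
  sval t (@Ordinal 2 0 isT) = a -> sval t (@Ordinal 2 1 isT) = b ->
  torus_act matrixA t (affpt 4 [:: x; y; z; w]) =
  affpt 4 [:: a * x; a * y; a * b * z; a / b * w].
Proof.
move=> <- <-; rewrite [LHS]affpt4E /torus_act /character !big_ord_recl !big_ord0 !mxE /=.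
have -> : ord0 = @Ordinal 2 0 isT by apply: val_inj.
have -> : lift (@Ordinal 2 0 isT) ord0 = @Ordinal 2 1 isT by apply: val_inj.
by rewrite !mulr1.
Qed.

Lemma character_alpha20 (t : torus R 2) :
  character alpha20 t = sval t (@Ordinal 2 0 isT) ^+ 2.
Proof.
rewrite /character !big_ord_recl !big_ord0 /=.
have -> : ord0 = @Ordinal 2 0 isT by apply: val_inj.
by rewrite !mulr1.
Qed.

Definition quotient_coord (i : 'I_3) : mpoly 4 C :=
  [:: coord_poly R (isT : 0 < 4)%N; coord_poly R (isT : 1 < 4)%N;
      coord_poly R (isT : 2 < 4)%N * coord_poly R (isT : 3 < 4)%N]`_i.

Lemma quotient_coordE (x y z w : C) i :
  meval (affpt 4 [:: x; y; z; w]) (quotient_coord i) = affpt 3 [:: x; y; z * w] i.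
Proof.
by case: i => -[|[|[|//]]] ?; rewrite /quotient_coord /affpt /= ?mevalM !meval_coord_poly.
Qed.

(** Where x = y = zw = 0, some torus element fixes the point but multiplies the value of any
    invariant section by a number other than 1, so this value is 0. Elsewhere one of x^2, y^2, zw is
    a nonzero invariant section with d = 1. *)
Lemma semistableP (v : affine_space R 4) : semistable matrixA alpha20 v <->
  exists i, meval v (quotient_coord i) != 0.
Proof.
have [x [y [z [w ->]]]] : exists x y z w, v = affpt 4 [:: x; y; z; w].
  by do 4 eexists; exact: affpt4E.
split=> [[d [G [d0 Ginv Gv]]]|[i Gi]].
  apply: contrapT => /forallNP H.
  have {}H i : affpt 3 [:: x; y; z * w] i = 0.
    by rewrite -quotient_coordE; apply/eqP/negPn/negP/H.
  have x0 : x = 0 := H (@Ordinal 3 0 isT).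
  have y0 : y = 0 := H (@Ordinal 3 1 isT).
  have zw : z * w = 0 := H (@Ordinal 3 2 isT).
  move: Gv; apply/negP/negPn/eqP.
  have n2 : 2 != 0 :> C by rewrite pnatr_eq0.
  (* With t1 = 2, t2 is chosen so that t1 t2 = 1 fixes z if w = 0, and so that t1/t2 = 1 fixes w
     otherwise, when z = 0. The section is multiplied by 4^d. *)
  have [t [ta tb]] : exists t : torus R 2, sval t (@Ordinal 2 0 isT) = 2 /\
      sval t (@Ordinal 2 1 isT) = if w == 0 then 2^-1 else 2.
    by apply: torus_of_neq0 => //; case: (w == 0); rewrite ?invr_eq0.
  have := Ginv t (affpt 4 [:: x; y; z; w]).
  rewrite (torus_act_matrixA _ _ _ _ ta tb) character_alpha20 ta x0 y0 mulr0.
  have -> : affpt 4 [:: 0; 0; 2 * (if w == 0 then 2^-1 else 2) * z;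
      2 / (if w == 0 then 2^-1 else 2) * w] = affpt 4 [:: 0; 0; z; w].
    have [->|w0] := eqVneq w 0; first by rewrite divff// mul1r mulr0.
    by move/eqP: zw; rewrite mulf_eq0 (negbTE w0) orbF => /eqP ->; rewrite divff// mul1r mulr0.
  move/eqP; rewrite -subr_eq0 -{1}[meval _ G]mul1r -mulrBl mulf_eq0 => /orP[|/eqP//].
  rewrite -exprM -natrX subr_eq0 (eqr_nat _ 1) -[X in X == _](expn0 2) eqn_exp2l//.
  by rewrite eq_sym muln_eq0/= eqn0Ngt d0.
(* x and y scale by t1 and have to be squared, whereas zw already scales by t1^2. *)
pose square (j : 'I_3) : mpoly 4 C :=
  if j == 2 :> nat then quotient_coord j else quotient_coord j ^+ 2.
exists 1%N, (square i); split=> //.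
  move=> t u; rewrite character_alpha20 expr1.
  have [a [b [c [e ->]]]] : exists a b c e, u = affpt 4 [:: a; b; c; e].
    by do 4 eexists; exact: affpt4E.
  have t0 := svalP t (@Ordinal 2 1 isT).
  rewrite (torus_act_matrixA _ _ _ _ erefl erefl) /square /quotient_coord.
  case: i {Gi} => -[|[|[|//]]] ? /=;
    rewrite ?expr2 !mevalM !meval_coord_poly /=; [by ring|by ring|].
  by rewrite mulrACA; congr (_ * _); rewrite mulrACA divff// mulr1.
by rewrite /square; case: ifP => // _; rewrite expr2 mevalM mulf_neq0.
Qed.

Lemma quotient_coord_neq0 (v : Vss) : exists i, meval (\val v) (quotient_coord i) != 0.
Proof. exact/semistableP/set_valP. Qed.

Definition quotient_map (v : Vss) : Q := toQ (mkpunct (quotient_coord_neq0 v)).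

Lemma quotient_map_morphism : morphism quotient_map.
Proof. exact: toQ_polynomial_morphism. Qed.

(** * A section of the quotient map, and invariance *)

Definition section_coord (i : 'I_4) : mpoly 3 C :=
  [:: coord_poly R (isT : 0 < 3)%N; coord_poly R (isT : 1 < 3)%N;
      coord_poly R (isT : 2 < 3)%N; 1]`_i.

Lemma section_coordE (x y z : C) :
  (fun i => meval (affpt 3 [:: x; y; z]) (section_coord i)) = affpt 4 [:: x; y; z; 1].
Proof. by rewrite [LHS]affpt4E /section_coord /= meval1 !meval_coord_poly. Qed.

Lemma section_semistable (u : punct) :
  ((fun i => meval (\val u) (section_coord i)) : affine_space R 4)
    \in semistable matrixA alpha20.
Proof.
apply/mem_set/semistableP.
have [i ui] : exists i, \val u i != 0.
  apply: contrapT => /forallNP H; apply: (set_valP u); apply: funext => i.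
  exact/eqP/negPn/negP/H.
by exists i; move: ui; rewrite (affpt3E (\val u)) section_coordE quotient_coordE mulr1.
Qed.

Definition section_map (u : punct) : Vss :=
  @exist (affine_space R 4) (fun v => v \in semistable matrixA alpha20) _
    (section_semistable u).

Lemma section_map_morphism : morphism section_map.
Proof.
apply: morphism_subspace; first exact/geometric_sheaf/geometric_punct.
exact: polynomial_map_morphism.
Qed.

Lemma section_mapK u : quotient_map (section_map u) = toQ u.
Proof.
congr toQ; apply: val_inj; apply: funext => i /=.
by rewrite (affpt3E (\val u)) section_coordE quotient_coordE mulr1.
Qed.

Lemma quotient_map_invariant :
  invariant_map (@semistable_torus_act R 2 4 matrixA alpha20) quotient_map.
Proof.
(* The torus acts on (x, y, zw) through t1, with weights 1, 1, 2; the inverse leads from the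
   translate back to [v]. *)
move=> t v; apply/toQP; exists (sval t (@Ordinal 2 0 isT))^-1.
  by rewrite invr_eq0; exact: (svalP t).
have t0 := svalP t (@Ordinal 2 0 isT); have t1 := svalP t (@Ordinal 2 1 isT).
have vE w : \val (mkpunct (quotient_coord_neq0 w)) =
    (fun i => meval (\val w) (quotient_coord i)) :> affine_space R 3 by [].
rewrite !vE; have -> : \val (semistable_torus_act t v) = torus_act matrixA t (\val v) by [].
move=> i; rewrite (affpt4E (\val v)) (torus_act_matrixA _ _ _ _ erefl erefl) !quotient_coordE.
case: i => -[|[|[|//]]] ?; rewrite /affpt /weights112 /= ?expr1 ?mulKf//.
by field; rewrite t0 t1.
Qed.

(** * Invariant maps on orbits and on orbit closures *)

Lemma invariant_torus_act (T : Type) (f : Vss -> T) (v v' : Vss) (a b : C) :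
  invariant_map (@semistable_torus_act R 2 4 matrixA alpha20) f ->
  a != 0 -> b != 0 ->
  (forall x y z w, \val v = affpt 4 [:: x; y; z; w] ->
     \val v' = affpt 4 [:: a * x; a * y; a * b * z; a / b * w]) -> f v' = f v.
Proof.
move=> finv a0 b0 vv'; have [t [ta tb]] := torus_of_neq0 a0 b0.
rewrite -(finv t v); congr f; apply: val_inj.
by rewrite (vv' _ _ _ _ (affpt4E (\val v))) -(torus_act_matrixA _ _ _ _ ta tb) -affpt4E.
Qed.

(** The numbers 1, ..., [size p] are too many to be all roots. *)
Lemma nonroot_neq0 (p : {poly C}) : p != 0 -> exists2 s, s != 0 & p.[s] != 0.
Proof.
move=> p0; apply: contrapT => H.
pose rs := [seq (i.+1)%:R : C | i <- iota 0 (size p)].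
suff : (size rs < size p)%N by rewrite size_map size_iota ltnn.
apply: max_poly_roots => //.
  apply/allP => _ /mapP[i _ ->]; apply/negPn/negP => pi0; apply: H.
  by exists (i.+1)%:R; rewrite ?pnatr_eq0.
rewrite map_inj_uniq ?iota_uniq// => i j /eqP.
by rewrite eqr_nat => /eqP[].
Qed.

(** The origin is not isolated: [U] contains the non-vanishing locus of a polynomial that is nonzero
    at 0, and such a polynomial is nonzero at some other point too. *)
Lemma line_open_meets_torus (U : set (affine_space R 1)) : open U ->
  U (affpt 1 [:: 0]) -> exists2 s, s != 0 & U (affpt 1 [:: s]).
Proof.
move=> oU /(zariski_open_basic oU)[P P0 PU].
have [p pE] : exists p : {poly C}, forall s, p.[s] = meval (affpt 1 [:: s]) P.
  elim/mpoly_ring_ind: P {P0 PU} => [c|i|P P' [p pE] [p' pE']|P P' [p pE] [p' pE']].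
  - by exists c%:P => s; rewrite hornerC mevalC.
  - by exists 'X => s; rewrite hornerX mevalXU; case: i => -[|//].
  - by exists (p + p') => s; rewrite hornerD mevalD pE pE'.
  - by exists (p * p') => s; rewrite hornerM mevalM pE pE'.
have p0 : p != 0.
  by apply: contraNneq P0 => p0; rewrite -pE p0 horner0.
have [s s0 ps] := nonroot_neq0 p0.
by exists s => //; apply: PU; rewrite -pE.
Qed.

Lemma affine_variety_closed n (Z : set (affine_space R n)) :
  closed Z -> affine_variety (subspace_of Z).
Proof.
move=> cZ; exists n, Z; split=> //; exists id, id.
have id_morphism : morphism (id : subspace_of Z -> subspace_of Z).
  by split=> //; move=> ?; exact: cvg_id.
by split.
Qed.

(* The punctured line s != 0 lies in one orbit, and separatedness of the target
   makes f constant along the whole line. *)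
Lemma invariant_limit (Q' : funspace R) (f : Vss -> Q') (v v' : Vss) (x y z w : C) :
  Defs.separated Q' -> morphism f ->
  invariant_map (@semistable_torus_act R 2 4 matrixA alpha20) f ->
  z * w = 0 -> \val v = affpt 4 [:: x; y; z; w] ->
  \val v' = affpt 4 [:: x; y; 0; 0] -> f v = f v'.
Proof.
move=> sQ' mf finv zw vE v'E.
pose L : set (affine_space R 1) := setT.
pose S := coord_poly R (isT : 0 < 1)%N.
(* [P] is the line s -> (x, y, sz, sw), equal to v' at s = 0; [P1] is the constant map to v, so that
   separatedness can compare two morphisms from the line. *)
pose P (i : 'I_4) : mpoly 1 C :=
  [:: mpolyC 1 x; mpolyC 1 y; S * mpolyC 1 z; S * mpolyC 1 w]`_i.
pose P1 (i : 'I_4) : mpoly 1 C :=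
  [:: mpolyC 1 x; mpolyC 1 y; mpolyC 1 z; mpolyC 1 w]`_i.
have PE (s : affine_space R 1) : (fun i => meval s (P i)) =
    affpt 4 [:: x; y; s (@Ordinal 1 0 isT) * z; s (@Ordinal 1 0 isT) * w].
  by rewrite [LHS]affpt4E /P /= !mevalM !mevalC !mevalXU.
have P1E (s : affine_space R 1) : (fun i => meval s (P1 i)) = affpt 4 [:: x; y; z; w].
  by rewrite [LHS]affpt4E /P1 /= !mevalC.
have xy : x != 0 \/ y != 0.
  have [i +] := quotient_coord_neq0 v'; rewrite v'E quotient_coordE.
  by case: i => -[|[|[|//]]] ?; rewrite /affpt /= ?mulr0 ?eqxx; [left|right|].
have ssP (s : subspace_of L) :
    ((fun i => meval (\val s) (P i)) : affine_space R 4) \in semistable matrixA alpha20.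
  apply/mem_set/semistableP; rewrite PE; set v0 := affpt 4 _.
  case: xy => h; [exists (@Ordinal 3 0 isT)|exists (@Ordinal 3 1 isT)];
  by rewrite /quotient_coord /= meval_coord_poly.
have ssP1 (s : subspace_of L) :
    ((fun i => meval (\val s) (P1 i)) : affine_space R 4) \in semistable matrixA alpha20.
  by rewrite P1E -vE; exact: valP.
pose l (s : subspace_of L) : Vss :=
  @exist (affine_space R 4) (fun v => v \in semistable matrixA alpha20) _ (ssP s).
pose l1 (s : subspace_of L) : Vss :=
  @exist (affine_space R 4) (fun v => v \in semistable matrixA alpha20) _ (ssP1 s).
have sL : sheaf_of_functions (subspace_of L).
  exact/geometric_sheaf/subspace_geometric/affine_geometric.
have ml : morphism l by apply: morphism_subspace => //; exact: polynomial_map_morphism.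
have ml1 : morphism l1 by apply: morphism_subspace => //; exact: polynomial_map_morphism.
have cL := sQ' _ _ _ (affine_variety_closed (closedT : closed L))
  (morphism_comp ml mf) (morphism_comp ml1 mf).
pose pt (s : C) : subspace_of L :=
  @exist (affine_space R 1) (fun v => v \in L) _ (in_setT (affpt 1 [:: s])).
have l1E s : l1 s = v by apply: val_inj; rewrite vE; exact: P1E.
have ptE s : \val (l (pt s)) = affpt 4 [:: x; y; s * z; s * w] by exact: PE.
have -> : v' = l (pt 0) by apply: val_inj; rewrite v'E ptE !mul0r.
have [//|neq] := pselect (f v = f (l (pt 0))).
(* Otherwise the complement of the coincidence set is open and contains 0, hence also some nonzero
   s. *)
have [U oU UE] := (open_subspace _).1 (closed_openC cL).
have U0 : U (affpt 1 [:: 0]).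
  have : (\val @^-1` U) (pt 0) by rewrite UE /= l1E => e; apply: neq.
  by [].
have [s s0 Us] := line_open_meets_torus oU U0.
have : (\val @^-1` U) (pt s) by [].
rewrite UE /= l1E; case.
(* With t1 = 1, t2 = s scales z by s and t2 = 1/s scales w by s; as zw = 0, only one of the two
   coordinates has to be matched. *)
have b0 : (if w == 0 then s else s^-1) != 0 by case: ifP; rewrite ?invr_eq0.
apply: (invariant_torus_act finv (oner_neq0 _) b0) => x' y' z' w' v'E'.
have {v'E'} e : affpt 4 [:: x; y; z; w] = affpt 4 [:: x'; y'; z'; w'] by rewrite -vE.
rewrite ptE.
have <- : x = x' := congr1 (@^~ (@Ordinal 4 0 isT)) e.
have <- : y = y' := congr1 (@^~ (@Ordinal 4 1 isT)) e.
have <- : z = z' := congr1 (@^~ (@Ordinal 4 2 isT)) e.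
have <- : w = w' := congr1 (@^~ (@Ordinal 4 3 isT)) e.
rewrite !mul1r; have [->|w0] := eqVneq w 0; first by rewrite !mulr0.
move/eqP: zw; rewrite mulf_eq0 (negbTE w0) orbF => /eqP ->.
by rewrite !mulr0 invrK.
Qed.

(** If w is nonzero, (1, w) carries v = (x, y, z, w) to (x, y, zw, 1). If w = 0, both (x, y, z, 0)
    and (x, y, 0, 1) degenerate to (x, y, 0, 0), where f takes the same value as at either. *)
Lemma invariant_section_map (Q' : funspace R) (f : Vss -> Q') (v : Vss) :
  Defs.separated Q' -> morphism f ->
  invariant_map (@semistable_torus_act R 2 4 matrixA alpha20) f ->
  f (section_map (mkpunct (quotient_coord_neq0 v))) = f v.
Proof.
move=> sQ' mf finv; set s := section_map _.
have [x [y [z [w vE]]]] : exists x y z w, \val v = affpt 4 [:: x; y; z; w].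
  by do 4 eexists; exact: affpt4E.
have sE : \val s = affpt 4 [:: x; y; z * w; 1].
  have -> : \val s = (fun i => meval (\val (mkpunct (quotient_coord_neq0 v)))
    (section_coord i)) :> affine_space R 4 by [].
  have -> : \val (mkpunct (quotient_coord_neq0 v)) = affpt 3 [:: x; y; z * w].
    by apply: funext => i; rewrite -quotient_coordE -vE.
  exact: section_coordE.
have [w0|w0] := eqVneq w 0; last first.
  apply: (invariant_torus_act finv (oner_neq0 _) w0) => x' y' z' w' v'E.
  have e : affpt 4 [:: x; y; z; w] = affpt 4 [:: x'; y'; z'; w'] by rewrite -vE.
  rewrite sE.
  have <- : x = x' := congr1 (@^~ (@Ordinal 4 0 isT)) e.
  have <- : y = y' := congr1 (@^~ (@Ordinal 4 1 isT)) e.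
  have <- : z = z' := congr1 (@^~ (@Ordinal 4 2 isT)) e.
  have <- : w = w' := congr1 (@^~ (@Ordinal 4 3 isT)) e.
  by rewrite !mul1r [w * z]mulrC mulVf.
have ss0 : affpt 4 [:: x; y; 0; 0] \in semistable matrixA alpha20.
  apply/mem_set/semistableP.
  have [i vi] := quotient_coord_neq0 v; exists i; move: vi.
  by rewrite vE !quotient_coordE w0 !mulr0.
pose v0 : Vss := @exist (affine_space R 4) (fun v => v \in semistable matrixA alpha20) _ ss0.
transitivity (f v0).
  by apply: (invariant_limit sQ' mf finv _ sE) => //; rewrite w0 !(mulr0, mul0r).
by apply/esym; apply: (invariant_limit sQ' mf finv _ vE) => //; rewrite w0 mulr0.
Qed.

(** The torus element (l, l) carries (x, y, z, 1) to (lx, ly, l^2 z, 1). *)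
Lemma section_map_toQ (T : Type) (f : Vss -> T) u u' :
  invariant_map (@semistable_torus_act R 2 4 matrixA alpha20) f ->
  toQ u = toQ u' -> f (section_map u') = f (section_map u).
Proof.
move=> finv /toQP[l l0 uu'].
apply: (invariant_torus_act finv l0 l0) => x y z w sE.
have e : affpt 4 [:: \val u (@Ordinal 3 0 isT); \val u (@Ordinal 3 1 isT);
    \val u (@Ordinal 3 2 isT); 1] = affpt 4 [:: x; y; z; w].
  by rewrite -section_coordE -affpt3E -sE.
have <- : _ = x := congr1 (@^~ (@Ordinal 4 0 isT)) e.
have <- : _ = y := congr1 (@^~ (@Ordinal 4 1 isT)) e.
have <- : _ = z := congr1 (@^~ (@Ordinal 4 2 isT)) e.
have <- : _ = w := congr1 (@^~ (@Ordinal 4 3 isT)) e.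
rewrite divff// mul1r.
transitivity ((fun i => meval (\val u') (section_coord i)) : affine_space R 4); first by [].
by rewrite (affpt3E (\val u')) section_coordE !uu' /weights112 /= !expr1 expr2.
Qed.

End Semistable.

Theorem theorem4p1 (R : realType) :
  exists p : semistable_locus R matrixA alpha20 ->
             weighted_projective_space R weights112,
    categorical_quotient (@semistable_torus_act R 2 4 matrixA alpha20) p.
Proof.
exists (@quotient_map R); split.
- exact: variety_Q.
- exact: quotient_map_morphism.
- exact: quotient_map_invariant.
move=> Q' f [_ _ sQ'] mf finv.
(* The choice of representative is immaterial, since [f \o section_map] is constant on weighted
   orbits. *)
pose h (q : weighted_projective_space R weights112) := f (section_map (repr q)).
have hE u : h (toQ u) = f (section_map u).
  by apply: section_map_toQ => //; rewrite toQ_repr.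
exists h; split.
  split; last by apply: funext => v; rewrite /= hE invariant_section_map.
  (* Being a morphism is tested on the punctured space, where [h] becomes [f \o section_map]. *)
  apply: morphism_quotient.
  have -> : h \o \pi_({eq_quot (weighted_orbit_equiv R weights112)}) = f \o @section_map R.
    by apply: funext => u; exact: hE.
  exact: (morphism_comp (@section_map_morphism R) mf).
(* Every point is the image under the quotient map of a point of the section, so [f] determines
   [h']. *)
move=> h' [_ h'f]; apply: funext => q; have [u ->] := toQ_surj q.
by rewrite hE -section_mapK -h'f.
Qed.
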